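(* Let $\sigma$ and $\tau$ be possibly empty connected non-crossing partitions. Then $1[\sigma]1[\tau]$ and $1[\tau]1[\sigma]$ are nc-equivalent, i.e. for every $n\ge0$ the number of partitions of $[n]$ avoiding both $1212$ and $1[\sigma]1[\tau]$ equals the number avoiding both $1212$ and $1[\tau]1[\sigma]$.
   Context: Set partitions are written in canonical sequential form (restricted growth words). Pattern containment means having a subsequence order-isomorphic to the pattern; a partition is non-crossing if it avoids $1212$. Bracket notation: in a word built from letters and bracketed partitions, $[\sigma]$ stands for $\sigma+r$ (add $r$ to every letter), where $r$ is the number of distinct symbols appearing before it (e.g. $1[12]1[1]=12314$; for empty $\sigma$, $1[\sigma]1[\tau]=11[\tau]$). $\alpha[\beta]$ is $\alpha$ followed by $\beta$ shifted by the number of blocks of $\alpha$; a partition is connected if it cannot be written as $\alpha[\beta]$ with $\alpha,\beta$ nonempty. *)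

(* Defs.v *)
From mathcomp Require Import all_boot.
Set Implicit Arguments. Unset Strict Implicit. Unset Printing Implicit Defensive.

Fixpoint rgw_from (m : nat) (s : seq nat) : bool :=
  match s with
  | [::] => true
  | x :: s' => (0 < x <= m.+1) && rgw_from (maxn m x) s'
  end.
Definition rgw (s : seq nat) : bool := rgw_from 0 s.

Definition nblocks (s : seq nat) : nat := foldr maxn 0 s.

Definition shiftw (r : nat) (s : seq nat) : seq nat := map (addn r) s.

Definition concat_part (a b : seq nat) : seq nat := a ++ shiftw (nblocks a) b.

Definition connected (s : seq nat) : Prop :=
  ~ exists a b, [/\ rgw a, rgw b, a != [::], b != [::] & s = concat_part a b].

Definition order_iso (u v : seq nat) : bool :=
  (size u == size v) &&
  [forall i : 'I_(size u), forall j : 'I_(size u),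
     (nth 0 u i < nth 0 u j) == (nth 0 v i < nth 0 v j)].

Definition containsb (w p : seq nat) : bool :=
  has (fun m : (size w).-tuple bool => order_iso (mask m w) p) (enum {: (size w).-tuple bool}).

Definition noncrossing (s : seq nat) : bool := ~~ containsb s [:: 1; 2; 1; 2].

Definition one_sig_one_tau (sigma tau : seq nat) : seq nat :=
  [:: 1] ++ shiftw 1 sigma ++ [:: 1] ++ shiftw (1 + nblocks sigma) tau.

(* Set partitions of [n] as restricted growth words of length n; all letters
   are <= n, so they are encoded as n-tuples over 'I_(n.+1). *)
Definition avoid_count (n : nat) (p : seq nat) : nat :=
  #|[set t : n.-tuple 'I_n.+1 |
      rgw (map val t) &&
      ~~ containsb (map val t) [:: 1; 2; 1; 2] &&
      ~~ containsb (map val t) p ]|.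

(* Main.v *)
(* Write a nonempty non-crossing partition as 1[w_1]1[w_2]...1[w_k], and let p = 1[sigma]1[tau].
   As sigma and tau are connected, an occurrence of either one in [w_1]...[w_k] lies
   in a single w_i, so that w avoids p iff every w_i avoids p and there are no i < j with
   sigma in w_i and tau in w_j. For p' = 1[tau]1[sigma] the condition is the same up to
   reversing the sequence w_1, ..., w_k, but this reversal does not preserve containment of
   sigma or of tau, so it cannot simply be iterated. Instead one counts: a word that avoids
   sigma or tau avoids both p and p', so as soon as the numbers of p-avoiders and of
   p'-avoiders of some length agree, they agree jointly with the containment of sigma and of
   tau. By induction this refined statement holds for the lengths of the w_i, and reversal
   then gives the equality of the totals. *)
Require Import Defs.
From HB Require Import structures.
From mathcomp Require Import all_boot zify.
Set Implicit Arguments. Unset Strict Implicit. Unset Printing Implicit Defensive.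

(** * Subsequences and order isomorphism *)

Lemma subseq_of_cat (T : eqType) (s x y : seq T) :
  subseq s (x ++ y) ->
  exists s1 s2, [/\ s = s1 ++ s2, subseq s1 x & subseq s2 y].
Proof.
case/subseqP=> m; rewrite size_cat => szm ->.
rewrite -(cat_take_drop (size x) m) mask_cat ?size_takel ?szm ?leq_addr //.
by do 2!eexists; split; [reflexivity| exact: mask_subseq..].
Qed.

Lemma subseq_catl (T : eqType) (s x y : seq T) :
  all (fun a => a \notin y) s -> subseq s (x ++ y) -> subseq s x.
Proof.
move=> /allP sNy /subseq_of_cat[s1 [[|a s2] [def_s sub1 sub2]]].
  by rewrite def_s cats0.
have /sNy/negP[] : a \in s by rewrite def_s mem_cat mem_head orbT.
by rewrite (mem_subseq sub2) ?mem_head.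
Qed.

Lemma subseq_catr (T : eqType) (s x y : seq T) :
  all (fun a => a \notin x) s -> subseq s (x ++ y) -> subseq s y.
Proof.
by rewrite -subseq_rev -all_rev rev_cat => sNx /subseq_catl;
  rewrite subseq_rev => -> //; apply/allP=> a /(allP sNx); rewrite mem_rev.
Qed.

Lemma subseq_rcons_catl (T : eqType) (s x y : seq T) a :
  a \notin y -> subseq (rcons s a) (x ++ y) -> subseq (rcons s a) x.
Proof.
move=> aNy /subseq_of_cat[s1 [s2 [def_s sub1 sub2]]].
case/lastP: s2 => [|s2 b] in def_s sub2; first by rewrite def_s cats0.
move: def_s; rewrite -rcons_cat => /rcons_inj[_ ab].
by case/negP: aNy; rewrite ab (mem_subseq sub2) // mem_rcons mem_head.
Qed.

Lemma cat_eq_cat (T : Type) (x y s1 s2 : seq T) :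
  x ++ y = s1 ++ s2 ->
  (exists z, s1 = x ++ z /\ y = z ++ s2) \/ (exists z, x = s1 ++ z /\ s2 = z ++ y).
Proof.
elim: x s1 => [|a x IHx] [|b s1] /=; first by left; exists [::].
- by move=> ->; left; exists (b :: s1).
- by move=> <-; right; exists (a :: x).
by case=> -> /IHx[][z [-> ->]]; [left|right]; exists z.
Qed.

(** Since [a] cannot be matched inside [x], the part matched there ends before [a]. With [a] the
    repeated first letter of a pattern, this limits how an occurrence can straddle a join. *)
Lemma subseq_cat_cons_right (T : eqType) a (s t x y : seq T) :
  a \notin x -> subseq (s ++ a :: t) (x ++ y) ->
  exists s1 s2, [/\ s = s1 ++ s2, subseq s1 x & subseq (s2 ++ a :: t) y].
Proof.
move=> aNx /subseq_of_cat[s1 [s2 [/cat_eq_cat[][z [def1 def2]] sub1 sub2]]].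
  case: z => [|b z] in def1 def2 *.
    by exists s, [::]; rewrite cats0 /= def2; split=> //; rewrite -[s]cats0 -def1.
  case/negP: aNx; apply: (mem_subseq sub1); case: def2 => -> _.
  by rewrite def1 mem_cat mem_head orbT.
by exists s1, z; rewrite -def2.
Qed.

Lemma subseq_cat_cons_left (T : eqType) a (s t x y : seq T) :
  a \notin y -> subseq (s ++ a :: t) (x ++ y) ->
  exists t1 t2, [/\ t = t1 ++ t2, subseq (s ++ a :: t1) x & subseq t2 y].
Proof.
move=> aNy; rewrite -subseq_rev rev_cat rev_cons cat_rcons rev_cat.
case/subseq_cat_cons_right; rewrite ?mem_rev // => s1 [s2 [def_t sub1 sub2]].
exists (rev s2), (rev s1); split.
- by rewrite -rev_cat -def_t revK.
- by rewrite -subseq_rev rev_cat rev_cons revK cat_rcons.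
- by rewrite -subseq_rev revK.
Qed.

Definition increasing_on (s : seq nat) (f : nat -> nat) :=
  {in s &, {homo f : x y / x < y}}.

(** Comparing positions amounts to relabelling by an increasing map, a form that composes and
    restricts to factors of the pattern. *)
Lemma order_isoP (u v : seq nat) :
  reflect (exists2 f, increasing_on v f & u = map f v) (order_iso u v).
Proof.
apply: (iffP andP) => [[/eqP sz /forallP iso]|[f f_inc ->]]; last first.
  split; first by rewrite size_map.
  have fE x y : x \in v -> y \in v -> (f x < f y) = (x < y).
    move=> xv yv; case: (ltngtP x y) => [/f_inc->//|/f_inc|->]; last exact: ltnn.
    by move=> /(_ yv xv) /ltnW; rewrite leqNgt => /negbTE.
  apply/forallP=> i; apply/forallP=> j.
  have lt (k : 'I_(size (map f v))) : k < size v.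
    by apply: leq_trans (ltn_ord k) _; rewrite size_map.
  by rewrite !(nth_map 0) ?lt // fE ?mem_nth ?lt.
have ltE i j : i < size v -> j < size v ->
    (nth 0 u i < nth 0 u j) = (nth 0 v i < nth 0 v j).
  rewrite -sz => lti ltj.
  by have /forallP/(_ (Ordinal ltj))/eqP := iso (Ordinal lti).
(* [index] picks the first position of a letter; any other would do, because equal letters of [v]
   face equal letters of [u], as shown below. *)
exists (fun x => nth 0 u (index x v)).
  by move=> x y xv yv /= xy; rewrite ltE ?index_mem // !nth_index.
apply: (@eq_from_nth _ 0) => [|i]; rewrite ?size_map ?sz // => lti.
rewrite (nth_map 0) //; set j := index _ v.
have ltj : j < size v by rewrite index_mem mem_nth.
have vE : nth 0 v j = nth 0 v i by rewrite nth_index ?mem_nth.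
apply/eqP; rewrite eqn_leq leqNgt [X in _ && X]leqNgt !ltE // vE.
by rewrite ltnn.
Qed.

Lemma contains_isoP (w p : seq nat) :
  reflect (exists2 s, order_iso s p & subseq s w) (containsb w p).
Proof.
apply: (iffP hasP) => [[m _ iso]|[s iso /subseqP[m sz def_s]]].
  by exists (mask m w) => //; apply: mask_subseq.
have szm : size m == size w by apply/eqP.
by exists (Tuple szm); rewrite ?mem_enum //= -def_s.
Qed.

Lemma containsP (w p : seq nat) :
  reflect (exists2 f, increasing_on p f & subseq (map f p) w) (containsb w p).
Proof.
apply: (iffP (contains_isoP w p)) => [[s /order_isoP[f f_inc ->]]|[f f_inc sub]].
  by exists f.
by exists (map f p) => //; apply/order_isoP; exists f.
Qed.

Lemma contains_subseq w w' p : subseq w w' -> containsb w p -> containsb w' p.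
Proof.
move=> sub /contains_isoP[s iso ss]; apply/contains_isoP; exists s => //.
exact: subseq_trans ss sub.
Qed.

Lemma contains_pattern p q g w :
  increasing_on q g -> subseq (map g q) p -> containsb w p -> containsb w q.
Proof.
move=> g_inc gq /containsP[f f_inc fs]; apply/containsP; exists (f \o g).
  by move=> x y xq yq xy; apply: f_inc (g_inc _ _ xq yq xy);
    apply/(mem_subseq gq)/map_f.
by rewrite map_comp; apply: subseq_trans fs; apply: map_subseq.
Qed.

Lemma noncrossingP w :
  reflect (forall a b, a < b -> ~~ subseq [:: a; b; a; b] w) (noncrossing w).
Proof.
apply: (iffP idP) => [nc a b ab|nc].
  apply: contra nc => sub; apply/containsP.
  exists (fun x => if x == 1 then a else b) => //.
  by move=> x y; rewrite !inE => /or4P[]/eqP-> /or4P[]/eqP->.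
apply/negP => /containsP[f f_inc] /=; apply/negP/nc.
by apply: f_inc; rewrite ?inE.
Qed.

(** * Restricted growth words and connectedness *)

Lemma leq_nblocks x s : x \in s -> x <= nblocks s.
Proof.
elim: s => //= y s IHs; rewrite inE leq_max => /orP[/eqP->|/IHs->].
  by rewrite leqnn.
by rewrite orbT.
Qed.

Lemma rgw_from_gt0 m s x : rgw_from m s -> x \in s -> 0 < x.
Proof.
elim: s m => //= y s IHs m /andP[/andP[y_gt0 _] /IHs IH].
by rewrite inE => /orP[/eqP->|].
Qed.

Lemma rgw_gt0 s x : rgw s -> x \in s -> 0 < x.
Proof. exact: rgw_from_gt0. Qed.

Lemma rgw_from_cat m s t :
  rgw_from m (s ++ t) = rgw_from m s && rgw_from (maxn m (nblocks s)) t.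
Proof.
elim: s m => [|x s IHs] m /=; first by rewrite maxn0.
by rewrite IHs maxnA andbA.
Qed.

Lemma rgw_from_shift m r s :
  rgw_from (r + m) (shiftw r s) -> {in shiftw r s, forall x, r < x} ->
  rgw_from m s.
Proof.
elim: s m => //= x s IHs m /andP[/andP[_ le]] rg gt_r.
have := gt_r _ (mem_head _ _) => gt_rx.
apply/andP; split; first by lia.
by apply: IHs => [|y ys]; [rewrite addn_maxr|apply: gt_r; rewrite inE ys orbT].
Qed.

Lemma shiftw_rgw_from m r s : rgw_from m s -> rgw_from (r + m) (shiftw r s).
Proof.
elim: s m => //= x s IHs m /andP[le /IHs]; rewrite addn_maxr => ->.
by rewrite andbT; lia.
Qed.

(** New letters of a restricted growth word appear in steps of one, so no value up to the maximum is
    skipped. The induction needs an arbitrary starting maximum [m]. *)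
Lemma rgw_mem s x : rgw s -> 0 < x <= nblocks s -> x \in s.
Proof.
suff gen m : rgw_from m s -> m < x <= nblocks s -> x \in s by exact: gen.
elim: s m => [|y s IHs] m /=; first by lia.
move=> /andP[ley /IHs{}IHs] ltx; rewrite inE; case: eqP => //= neq.
by apply: IHs; lia.
Qed.

Lemma unshiftw r s : {in s, forall x, r <= x} -> s = shiftw r (map (subn^~ r) s).
Proof.
move=> ge_r; rewrite /shiftw -map_comp map_id_in // => x /ge_r /= le.
by rewrite subnKC.
Qed.

(** If all of [x] lies below all of [y], then the letters of [y] exceed [nblocks x], and subtracting
    this number leaves a restricted growth word. Two nonempty factors would thus exhibit [s] as a
    [concat_part]. *)
Lemma connected_split s x y :
  rgw s -> connected s -> s = x ++ y ->
  {in x & y, forall a b, a < b} -> x = [::] \/ y = [::].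
Proof.
move=> rg conn def_s lt_xy.
case: x => [|a x] in def_s lt_xy *; first by left.
case: y => [|b y] in def_s lt_xy *; first by right.
case: conn; move: rg; rewrite def_s /rgw rgw_from_cat max0n => /andP[rgx rgy].
set r := nblocks _ in rgy.
(* The maximum of the first factor is itself one of its letters, hence below all of the second
   factor. *)
have rx : r \in a :: x.
  apply: rgw_mem => //; rewrite leqnn andbT.
  by apply: leq_trans (leq_nblocks (mem_head a x)); apply: (rgw_gt0 rgx); rewrite mem_head.
have gt_r : {in b :: y, forall z, r < z} by move=> z; apply: lt_xy.
have defy := unshiftw (fun z zy => ltnW (gt_r z zy)).
exists (a :: x), (map (subn^~ r) (b :: y)); split=> //; last first.
  by rewrite /concat_part -/r -defy.
by apply: (@rgw_from_shift 0 r); rewrite -defy ?addn0.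
Qed.

(** * Joining two words *)

Lemma map_increasing_factor p s f g :
  {homo g : x y / x < y} -> increasing_on p f -> map f p = map g s ->
  exists h, [/\ increasing_on p h, s = map h p & {in p, forall x, f x = g (h x)}].
Proof.
move=> g_inc f_inc eq_fg; exists (fun x => nth 0 s (index x p)).
have g_inj : injective g.
  by move=> x y; case: (ltngtP x y) => // /g_inc; lia.
have sz : size s = size p by rewrite -(size_map g) -eq_fg size_map.
have fE : {in p, forall x, f x = g (nth 0 s (index x p))}.
  move=> x xp; rewrite -(nth_map _ 0) ?sz ?index_mem // -eq_fg.
  by rewrite (nth_map 0) ?index_mem // nth_index.
split=> //.
  move=> x y xp yp /(f_inc _ _ xp yp); rewrite !fE //.
  by rewrite !ltnNge; apply: contra; rewrite leq_eqVlt => /orP[/eqP->//|/g_inc/ltnW].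
by apply: (inj_map g_inj); rewrite -eq_fg -map_comp; apply/eq_in_map.
Qed.

Lemma subseq_map_inv (s v : seq nat) g :
  subseq s (map g v) -> exists2 s', s = map g s' & subseq s' v.
Proof.
case/subseqP=> m _ ->; exists (mask m v); first by rewrite map_mask.
exact: mask_subseq.
Qed.

Lemma order_iso_map g s p :
  {homo g : x y / x < y} -> order_iso (map g s) p = order_iso s p.
Proof.
move=> g_inc; apply/order_isoP/order_isoP => [[f f_inc eq_fg]|[f f_inc ->]].
  by have [h [h_inc -> _]] := map_increasing_factor g_inc f_inc (esym eq_fg); exists h.
exists (g \o f); last by rewrite map_comp.
by move=> x y xp yp xy; apply/g_inc/f_inc.
Qed.

Lemma contains_mapE g w p :
  {homo g : x y / x < y} -> containsb (map g w) p = containsb w p.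
Proof.
move=> g_inc; apply/contains_isoP/contains_isoP => -[s iso sub].
  have [s' def_s sub'] := subseq_map_inv sub.
  by exists s' => //; rewrite -(order_iso_map _ _ g_inc) -def_s.
by exists (map g s); rewrite ?order_iso_map // map_subseq.
Qed.

Lemma shiftw_inc r : {homo addn r : x y / x < y}.
Proof. by move=> x y; rewrite ltn_add2l. Qed.

(** The letters 2, ..., [r.+1] are left free for the shifted first word. Fixing 0 along with 1 makes
    the map strictly increasing on all natural numbers. *)
Definition lift_above r x := if x <= 1 then x else x + r.

Lemma lift_above_inc r : {homo lift_above r : x y / x < y}.
Proof. by rewrite /lift_above => x y; do 2!case: ifP; lia. Qed.

(* The letter 1 of [v] becomes the first letter of the join. *)
Definition join u v := 1 :: shiftw 1 u ++ map (lift_above (nblocks u)) v.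

Lemma rgw_nil_or_1 v : rgw v -> v = [::] \/ exists v', v = 1 :: v'.
Proof.
case: v => [|x v]; [by left|rewrite /rgw /= => /andP[lex _]; right].
by exists v; congr (_ :: _); lia.
Qed.

Lemma rgw_from_lift_above m r v :
  0 < m -> rgw_from m v -> rgw_from (m + r) (map (lift_above r) v).
Proof.
elim: v m => //= x v IHs m m_gt0 /andP[lex rgv].
have -> : maxn (m + r) (lift_above r x) = maxn m x + r.
  by rewrite /lift_above; case: ifP; lia.
by rewrite IHs ?andbT //; rewrite /lift_above; [case: ifP|]; lia.
Qed.

Lemma nblocks_shiftw r s : maxn r (nblocks (shiftw r s)) = r + nblocks s.
Proof. by elim: s => [|x s IHs] /=; lia. Qed.

Lemma rgw_join u v : rgw u -> rgw v -> rgw (join u v).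
Proof.
move=> rgu rgv; rewrite /rgw /= rgw_from_cat (@shiftw_rgw_from 0 1) //=.
rewrite nblocks_shiftw; case: (rgw_nil_or_1 rgv) => [->//|[v' def_v]].
move: rgv; rewrite def_v /rgw /= => /(rgw_from_lift_above (nblocks u)) rgv'.
have -> : maxn (1 + nblocks u) (lift_above (nblocks u) 1) = 1 + nblocks u.
  by rewrite /lift_above /=; lia.
exact: rgv'.
Qed.

Section Join.
Variables u v : seq nat.
Hypotheses (rgu : rgw u) (rgv : rgw v).

Let r := nblocks u.
Let A := shiftw 1 u.
Let B := map (lift_above r) v.

Lemma join_left x : x \in A -> 1 < x <= r.+1.
Proof.
case/mapP=> y yu ->; rewrite add1n !ltnS leq_nblocks // andbT.
exact: rgw_gt0 yu.
Qed.

Lemma join_right x : x \in B -> x = 1 \/ r.+1 < x.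
Proof.
clear rgu; case/mapP=> y /(rgw_gt0 rgv) y_gt0 ->; rewrite /lift_above.
by case: ifP; lia.
Qed.

Lemma join_right_head : B = [::] \/ exists B', B = 1 :: B'.
Proof.
by rewrite /B; case: (rgw_nil_or_1 rgv) => [->|[v' ->]]; [left|right; eexists].
Qed.

Lemma subseq_join_left s :
  {in s, forall x, 1 < x <= r.+1} -> subseq s (join u v) -> subseq s A.
Proof.
move=> s_le; rewrite /join -cat1s catA => /subseq_catl sub.
have : subseq s (1 :: A).
  apply: sub; apply/allP=> x /s_le le; apply/negP => /join_right[]; lia.
by apply: (@subseq_catr _ _ [:: 1]); apply/allP => x /s_le; rewrite inE; lia.
Qed.

(** Keeping only the letters equal to 1 or above [r.+1] reduces the join to [1 :: B]. *)
Lemma subseq_join_right1 s :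
  {in s, forall x, x = 1 \/ r.+1 < x} -> subseq s (join u v) ->
  subseq s (1 :: B).
Proof.
move=> s_gt sub.
have : subseq s (filter (fun x => (x == 1) || (r.+1 < x)) (join u v)).
  by rewrite subseq_filter sub andbT; apply/allP=> x /s_gt; lia.
rewrite /join /= filter_cat -/A -/B.
have /eqP -> : filter (fun x => (x == 1) || (r.+1 < x)) A == [::].
  by rewrite -[_ == _]negbK -has_filter; apply/hasPn => x /join_left; lia.
have /all_filterP -> // : all (fun x => (x == 1) || (r.+1 < x)) B.
by apply/allP => x /join_right; lia.
Qed.

Lemma subseq_join_right s :
  {in s, forall x, r.+1 < x} -> subseq s (join u v) -> subseq s B.
Proof.
move=> s_gt sub; apply: (@subseq_catr _ _ [:: 1]).
  by apply/allP => x /s_gt; rewrite inE; lia.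
by apply: subseq_join_right1 => // x /s_gt; right.
Qed.

(** Each of [a] and [b] is 1, a letter of [A], or a larger letter of [B]. Two letters of the same
    side would cross in [u] or [v]; the mixed cases fail because no 1 occurs in [A] and no letter of
    [A] recurs in [B]. *)
Lemma noncrossing_join : noncrossing u -> noncrossing v -> noncrossing (join u v).
Proof.
move=> /noncrossingP ncu /noncrossingP ncv; apply/noncrossingP => a b ab.
apply/negP => sub.
have inW x : x \in [:: a; b; a; b] -> [\/ x = 1, 1 < x <= r.+1 | r.+1 < x].
  move/(mem_subseq sub); rewrite inE mem_cat => /or3P[/eqP|/join_left|/join_right[]].
  - by constructor 1.
  - by constructor 2.
  - by constructor 1.
  - by constructor 3.
have crossA : ~ (subseq [:: a; b; a; b] A).
  case/subseq_map_inv => s def_s sub'.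
  case: s def_s sub' => [|x [|y [|x' [|y' [|]]]]] //= [def_a def_b].
  rewrite def_a def_b => /addnI <- /addnI <-; apply/negP/ncu.
  by move: ab; rewrite def_a def_b.
have crossB : ~ (subseq [:: a; b; a; b] B).
  case/subseq_map_inv => s def_s sub'.
  have inj : injective (lift_above r).
    by move=> x y; case: (ltngtP x y) => // /(lift_above_inc r); lia.
  case: s def_s sub' => [|x [|y [|x' [|y' [|]]]]] //= [def_a def_b].
  rewrite def_a def_b => /inj <- /inj <-; apply/negP/ncv.
  by move: ab; rewrite def_a def_b /lift_above; do 2!case: ifP; lia.
have [a1|a2|a3] := inW a (mem_head _ _); last 1 first.
- by apply/crossB/subseq_join_right => // x; rewrite !inE => /or4P[]/eqP->; lia.
- have [b1|b2|b3] : [\/ b = 1, 1 < b <= r.+1 | r.+1 < b] by apply: inW; rewrite !inE eqxx orbT.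
  + lia.
  + have : subseq [:: a; b; a; b] ((1 :: A) ++ B) by [].
    move/(@subseq_rcons_catl _ [:: a; b; a]) => /=.
    rewrite a1 /= => subA; have : subseq [:: b; 1; b] A.
      by apply: subA; apply/negP => /join_right; lia.
    by move/mem_subseq/(_ 1); rewrite !inE eqxx orbT => /(_ isT)/join_left.
  + have : subseq [:: a; b; a; b] (1 :: B).
      by apply: subseq_join_right1 => // x; rewrite !inE => /or4P[]/eqP->; auto.
    have bN1 : (b == 1) = false by lia.
    (* The leading 1 of the join can be exchanged for the 1 at the head of [B], which moves the
       crossing into [B]. *)
    case: join_right_head => [->|[B' def_B]]; rewrite a1 /= ?bN1 //.
    move=> sub1; apply: crossB; rewrite a1 def_B /=.
    by move: sub1; rewrite def_B /= bN1.
- have [b1|b2|b3] : [\/ b = 1, 1 < b <= r.+1 | r.+1 < b] by apply: inW; rewrite !inE eqxx orbT.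
  + lia.
  + by apply/crossA/subseq_join_left => // x; rewrite !inE => /or4P[]/eqP->.
  + have : subseq [:: a; b; a; b] ((1 :: A) ++ B) by [].
    move/subseq_of_cat => [s1 [s2 [def_s sub1 sub2]]].
    have bNA : b \notin 1 :: A.
      by rewrite inE negb_or; apply/andP; split; [lia|apply/negP => /join_left; lia].
    have aNB : a \notin B by apply/negP => /join_right; lia.
    case: s1 => [|a' [|b' s1]] in def_s sub1 *; move: def_s => /= def_s.
    * by case/negP: aNB; apply: (mem_subseq sub2); rewrite -def_s mem_head.
    * by case/negP: aNB; apply: (mem_subseq sub2); case: def_s => _ <-; rewrite !inE eqxx orbT.
    * by case/negP: bNA; apply: (mem_subseq sub1); case: def_s => _ <- _; rewrite !inE eqxx orbT.
Qed.

End Join.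

(** * Decomposition of non-crossing partitions *)

(** [A] has no letter 1 and a nonempty [B] begins with 1, so the position of the second 1 of the
    join gives the size of the first word. *)
Lemma join_inj u v u' v' :
  rgw u -> rgw v -> rgw u' -> rgw v' -> join u v = join u' v' -> u = u' /\ v = v'.
Proof.
move=> rgu rgv rgu' rgv'.
have sizeE x y : rgw x -> rgw y ->
    size (shiftw 1 x) = index 1 (shiftw 1 x ++ map (lift_above (nblocks x)) y).
  move=> rgx rgy; rewrite index_cat ifN; last by apply/negP=> /(join_left rgx).
  by case: (rgw_nil_or_1 rgy) => [->|[y' ->]] /=; rewrite addn0.
case=> eqW; have /eqP := eqW; rewrite eqseq_cat; 
  last by rewrite (sizeE _ _ rgu rgv) (sizeE _ _ rgu' rgv') eqW.
case/andP=> /eqP/(inj_map (@addnI 1)) <- /eqP eqB; split=> //.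
apply: inj_map eqB => x y.
by case: (ltngtP x y) => // /(lift_above_inc (nblocks u)); lia.
Qed.

Lemma rgw_from_unlift_above m r v :
  0 < m -> {in v, forall x, 0 < x} ->
  rgw_from (m + r) (map (lift_above r) v) -> rgw_from m v.
Proof.
elim: v m => //= x v IHs m m_gt0 v_gt0 /andP[lex].
have x_gt0 := v_gt0 x (mem_head _ _).
have -> : maxn (m + r) (lift_above r x) = maxn m x + r.
  by rewrite /lift_above; case: ifP; lia.
move=> /IHs -> //; first by rewrite andbT; move: lex; rewrite /lift_above; case: ifP; lia.
- by lia.
- by move=> y yv; apply: v_gt0; rewrite inE yv orbT.
Qed.

(** The word is cut at its second 1. Non-crossing is what prevents the letters before the cut, other
    than 1, from recurring after it. *)
Lemma join_surj w :
  rgw w -> noncrossing w -> w != [::] ->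
  exists u v, [/\ rgw u /\ rgw v, noncrossing u, noncrossing v & w = join u v].
Proof.
move=> rgw_w ncw w_nil; case: (rgw_nil_or_1 rgw_w) w_nil => [->//|[w' def_w] _].
(* If there is no further 1, [index] returns the size of [w'] and [B] is empty. *)
pose A := take (index 1 w') w'; pose B := drop (index 1 w') w'.
have def_w' : w' = A ++ B by rewrite cat_take_drop.
have NA1 : 1 \notin A.
  apply/negP => /(nthP 0)[i]; rewrite size_take_min leq_min => /andP[lti _].
  by rewrite nth_take // => nth_i; have := before_find 0 lti; rewrite /= nth_i.
have headB : B = [::] \/ exists B', B = 1 :: B'.
  rewrite /B; case w'1: (1 \in w'); first by right; rewrite drop_index //; eexists.
  by left; apply/drop_oversize; rewrite leqNgt index_mem w'1.
move: rgw_w; rewrite def_w /rgw /= def_w' rgw_from_cat max0n => /andP[rgA rgB].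
have gtA : {in A, forall x, 1 < x}.
  move=> x xA; have := rgw_from_gt0 rgA xA.
  by have : x != 1 by [apply: contraNneq NA1 => <-]; lia.
have gtB : {in B, forall x, 0 < x} by move=> x; apply: rgw_from_gt0 rgB.
pose u := map (subn^~ 1) A; have defA : A = shiftw 1 u.
  by apply: unshiftw => x /gtA /ltnW.
have rgu : rgw u by apply: (@rgw_from_shift 0 1); rewrite -defA.
pose r := nblocks u.
(* A letter [x] of [B] between 2 and [r.+1] would also occur in [A]; together with the leading 1 and
   the 1 at the head of [B] it would form the crossing 1, [x], 1, [x]. *)
have farB : {in B, forall x, x <= 1 \/ r.+1 < x}.
  move=> x xB; case: (leqP x 1); [by left|right].
  rewrite ltnNge; apply/negP => le.
  have xA : x \in A.
    by rewrite defA -[x](@subnKC 1); [apply/map_f/rgw_mem|]; lia.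
  move/noncrossingP/(_ 1 x): ncw; case/(_ _)/negP; first by lia.
  rewrite def_w def_w' /= -(cat1s x).
  apply: cat_subseq; first by rewrite sub1seq.
  case: headB xB => [->//|[B' ->]]; rewrite inE => /orP[|xB'] /=; first by lia.
  by case: (B') xB' => // y s; rewrite -sub1seq.
pose v := map (fun x => if x <= 1 then x else x - r) B.
have defB : B = map (lift_above r) v.
  rewrite -map_comp map_id_in // => x xB /=; rewrite /lift_above.
  by case: (farB x xB); do 2![case: ifP]; lia.
have subA : subseq A w by rewrite def_w def_w'; exact: subseq_trans (prefix_subseq _ _) (subseq_cons _ _).
have subB : subseq B w by rewrite def_w def_w'; exact: subseq_trans (suffix_subseq _ _) (subseq_cons _ _).
have rgv : rgw v.
  have gtv : {in v, forall x, 0 < x}.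
    by move=> _ /mapP[x xB ->]; have := gtB x xB; case: (farB x xB); case: ifP; lia.
  move: rgB; rewrite [in X in rgw_from X]defA nblocks_shiftw {1}defB -/r.
  case: headB => [B0|[B' defB']]; first by rewrite /v B0.
  move/(@rgw_from_unlift_above 1 r v isT gtv).
  by have -> : v = 1 :: behead v by rewrite /v defB'.
exists u, v; split=> //.
- apply: contra ncw; rewrite -(@contains_mapE (addn 1)); last exact: shiftw_inc.
  by rewrite -/(shiftw 1 u) -defA; apply: contains_subseq.
- apply: contra ncw; rewrite -(@contains_mapE (lift_above r)); last exact: lift_above_inc.
  by rewrite -defB; apply: contains_subseq.
by rewrite /join -defA -defB.
Qed.

Lemma size_join u v : size (join u v) = (size u + size v).+1.
Proof. by rewrite /= size_cat !size_map. Qed.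

(** * Binary trees as codes of non-crossing partitions *)

Inductive tree := Leaf | Node of tree & tree.

Fixpoint tree_code t : GenTree.tree unit :=
  if t is Node u v then GenTree.Node 0 [:: tree_code u; tree_code v]
  else GenTree.Leaf tt.

Fixpoint tree_decode (c : GenTree.tree unit) :=
  match c with
  | GenTree.Node _ [:: u; v] =>
    if (tree_decode u, tree_decode v) is (Some u', Some v')
    then Some (Node u' v') else None
  | GenTree.Leaf _ => Some Leaf
  | _ => None
  end.

Lemma tree_codeK : pcancel tree_code tree_decode.
Proof. by elim=> //= u -> v ->. Qed.

HB.instance Definition _ := Equality.copy tree (pcan_type tree_codeK).

Fixpoint nb_nodes t := if t is Node u v then (nb_nodes u + nb_nodes v).+1 else 0.

Fixpoint word t := if t is Node u v then join (word u) (word v) else [::].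

Lemma rgw_word t : rgw (word t).
Proof. by elim: t => //= u rgu v rgv; apply: rgw_join. Qed.

Lemma noncrossing_word t : noncrossing (word t).
Proof.
elim: t => /= [|u ncu v ncv]; last by apply: noncrossing_join => //; apply: rgw_word.
by apply/noncrossingP.
Qed.

Lemma size_word t : size (word t) = nb_nodes t.
Proof. by elim: t => //= u <- v <-; rewrite size_cat !size_map. Qed.

Lemma word_inj : injective word.
Proof.
elim=> [|u IHu v IHv] [|u' v'] //= eqW.
have [/IHu-> /IHv->] // := join_inj (rgw_word _) (rgw_word _) (rgw_word _) (rgw_word _) eqW.
Qed.

Lemma word_surj w : rgw w -> noncrossing w -> exists t, w = word t.
Proof.
have [n] := ubnP (size w); elim: n w => // n IHn [|x w] lt rgw_w ncw; first by exists Leaf.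
have [//|u [v [[rgu rgv] ncu ncv def_w]]] := join_surj rgw_w ncw.
have szW := congr1 size def_w; rewrite size_join /= in szW lt.
have [tu def_u] : exists t, u = word t by apply: IHn => //; lia.
have [tv def_v] : exists t, v = word t by apply: IHn => //; lia.
by exists (Node tu tv); rewrite def_w def_u def_v.
Qed.

(** * Occurrences in a join *)

(** An order isomorphism reflects comparisons, so a cut of [s] into a low and a high factor comes
    from such a cut of [p], to which connectedness applies. *)
Lemma connected_iso_split p s x y :
  rgw p -> connected p -> order_iso s p -> s = x ++ y ->
  {in x & y, forall a b, a < b} -> x = [::] \/ y = [::].
Proof.
move=> rgp conn /order_isoP[f f_inc ->] def_s lt_xy.
have szx : size (take (size x) p) = size x.
  by apply/size_takel; rewrite -(size_map f p) def_s size_cat leq_addr.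
have [defx defy] : map f (take (size x) p) = x /\ map f (drop (size x) p) = y.
  by rewrite map_take map_drop def_s take_size_cat ?drop_size_cat.
have [||x0|y0] := @connected_split p (take (size x) p) (drop (size x) p) rgp conn.
- by rewrite cat_take_drop.
- move=> a b ap bp; have := lt_xy (f a) (f b).
  rewrite -[in X in X -> _]defx -[in X in _ -> X -> _]defy !map_f // => /(_ isT isT).
  have {}ap := mem_take ap; have {}bp := mem_drop bp.
  rewrite !ltnNge; apply: contra; rewrite leq_eqVlt => /orP[/eqP->//|ba].
  exact: ltnW (f_inc _ _ bp ap ba).
- by left; rewrite -defx x0.
- by right; rewrite -defy y0.
Qed.

(** The later case analysis places [s] and [t] separately in a join, so an occurrence is described
    by these pieces and the repeated letter [a] instead of one relabelling. *)
Lemma order_iso_patternP sigma tau q :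
  rgw sigma -> rgw tau ->
  reflect (exists a s t,
    [/\ q = a :: s ++ a :: t, order_iso s sigma /\ order_iso t tau,
        {in s, forall x, a < x}, {in t, forall x, a < x}
      & {in s & t, forall x y, x < y}])
  (order_iso q (one_sig_one_tau sigma tau)).
Proof.
move=> rgs rgt; set r := nblocks sigma.
have patP x : x \in one_sig_one_tau sigma tau ->
   [\/ x = 1, exists2 y, x = y.+1 & y \in sigma
     | exists2 y, x = (r + y).+1 & y \in tau].
  rewrite /one_sig_one_tau !mem_cat !mem_seq1 => /or4P[/eqP->|/mapP[y ys ->]|/eqP->|/mapP[y yt ->]].
  - by constructor 1.
  - by constructor 2; exists y.
  - by constructor 1.
  - by constructor 3; exists y.
have one_pat : 1 \in one_sig_one_tau sigma tau by rewrite mem_head.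
have sig_pat y : y \in sigma -> y.+1 \in one_sig_one_tau sigma tau.
  by move=> ys; rewrite !mem_cat (map_f (addn 1)) ?orbT.
have tau_pat y : y \in tau -> (r + y).+1 \in one_sig_one_tau sigma tau.
  by move=> ys; rewrite !mem_cat (map_f (addn (1 + r))) ?orbT.
apply: (iffP (order_isoP _ _)) => [[f f_inc ->]|].
  exists (f 1), (map (fun x => f x.+1) sigma), (map (fun x => f (r + x).+1) tau).
  split=> [||_ /mapP[x xs ->]|_ /mapP[x xt ->]|_ _ /mapP[x xs ->] /mapP[y yt ->]].
  - by rewrite /= map_cat /= -!map_comp.
  - by split; apply/order_isoP; eexists; try reflexivity; move=> x y xp yp xy;
      apply: f_inc; auto; lia.
  - by apply: f_inc; auto; have := rgw_gt0 rgs xs; lia.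
  - by apply: f_inc; auto; have := rgw_gt0 rgt xt; lia.
  - by apply: f_inc; auto; have := rgw_gt0 rgt yt; have := leq_nblocks xs; lia.
case=> a [_ [_ [-> [/order_isoP[f f_inc ->] /order_isoP[g g_inc ->]] lt_s lt_t lt_st]]].
(* Letters 2, ..., [r.+1] of the pattern come from [sigma] and larger ones from [tau]; the
   subtractions undo the two shifts. *)
pose F x := if x == 1 then a else if x <= r.+1 then f x.-1 else g (x.-1 - r).
have F1 : F 1 = a by [].
have Fs y : y \in sigma -> F y.+1 = f y.
  move=> ys; have := leq_nblocks ys; have := rgw_gt0 rgs ys.
  by rewrite /F eqSS ltnS -/r lt0n => /negbTE-> ->.
have Ft y : y \in tau -> F (r + y).+1 = g y.
  move=> yt; have y_gt0 := rgw_gt0 rgt yt; rewrite /F eqSS.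
  by rewrite !ifN /= ?addKn; lia.
exists F; last first.
  rewrite /= map_cat /= F1 -!map_comp; congr (_ :: _ ++ _ :: _); apply/esym/eq_in_map => x xp /=.
    exact: Fs.
  exact: Ft.
move=> _ _ /patP[->|[x -> xs]|[x -> xt]] /patP[->|[y -> ys]|[y -> yt]] xy.
- lia.
- by rewrite F1 Fs //; apply/lt_s/map_f.
- by rewrite F1 Ft //; apply/lt_t/map_f.
- lia.
- by rewrite !Fs //; apply: f_inc => //; lia.
- by rewrite Fs // Ft //; apply: lt_st; apply: map_f.
- lia.
- by have := leq_nblocks ys; rewrite -/r; lia.
- by rewrite !Ft //; apply: g_inc => //; lia.
Qed.

(** In a word [1[w_1]...1[w_k]] and for connected [p], this means that some [w_i] contains [p].
    Plain containment is too weak: the word [1] contains the pattern [1] by its own first letter.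
    For empty [p] the condition says that there is a 1, hence some bracket. *)
Definition contains_after_1 w p :=
  exists t, [/\ order_iso t p, {in t, forall x, 1 < x} & subseq (1 :: t) w].

Section JoinPattern.
Variables u v : seq nat.
Hypotheses (rgu : rgw u) (rgv : rgw v).

Let r := nblocks u.
Let A := shiftw 1 u.
Let B := map (lift_above r) v.

Lemma contains_join_left s p : order_iso s p -> subseq s A -> containsb u p.
Proof.
move=> iso sub; rewrite -(@contains_mapE (addn 1)); last exact: shiftw_inc.
by apply/contains_isoP; exists s.
Qed.

Lemma contains_join_right s p : order_iso s p -> subseq s B -> containsb v p.
Proof.
move=> iso sub; rewrite -(@contains_mapE (lift_above r)); last exact: lift_above_inc.
by apply/contains_isoP; exists s.
Qed.

Lemma contains_joinl p : containsb u p -> containsb (join u v) p.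
Proof.
rewrite -(contains_mapE _ _ (@shiftw_inc 1)); apply: contains_subseq.
exact: subseq_trans (prefix_subseq _ _) (subseq_cons _ _).
Qed.

Lemma contains_joinr p : containsb v p -> containsb (join u v) p.
Proof.
rewrite -(contains_mapE _ _ (@lift_above_inc r)); apply: contains_subseq.
exact: subseq_trans (suffix_subseq _ _) (subseq_cons _ _).
Qed.

Lemma contains_after_1_right p :
  contains_after_1 v p <-> contains_after_1 B p.
Proof.
split=> [] [t [iso gt1 sub]]; last first.
  case: (subseq_map_inv sub) => [[|x t'] //= [eq1 def_t] sub'].
  exists t'; split.
  - by rewrite -(@order_iso_map (lift_above r)) -?def_t //; apply: lift_above_inc.
  - move=> y yt'; have := gt1 (lift_above r y); rewrite def_t map_f // /lift_above.
    by case: ifP; lia.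
  - suff <- : x = 1 by [].
    by move: eq1; rewrite /lift_above; case: ifP; lia.
exists (map (lift_above r) t); split.
- by rewrite order_iso_map //; apply: lift_above_inc.
- by move=> _ /mapP[x /gt1 xt ->]; rewrite /lift_above; case: ifP; lia.
- exact: (map_subseq (lift_above r) sub).
Qed.

(** A nonempty [B] begins with 1 and [t] with a larger letter, so [t] is matched after that 1. *)
Lemma join_right_after_1 t :
  t != [::] -> {in t, forall x, 1 < x} -> subseq t B -> subseq (1 :: t) B.
Proof.
case: t => // x t _ gt1; case: (join_right_head u rgv); rewrite -/r -/B.
  by move=> ->.
case=> B' ->; have := gt1 x (mem_head _ _) => /=.
by case: (x =P 1) => // ->.
Qed.

Lemma join_lt x y : x \in A -> y \in B -> y != 1 -> x < y.
Proof. by move=> /(join_left rgu) xA /(join_right rgv); rewrite -/r in xA *; lia. Qed.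

(** Letters of [B] other than 1 exceed those of [A], so connectedness prevents an occurrence from
    straddling the two. *)
Lemma contains_after_1_join p :
  rgw p -> connected p ->
  contains_after_1 (join u v) p <-> containsb u p \/ contains_after_1 v p.
Proof.
move=> rgp conn; split=> [[t [iso gt1 sub]]|].
  have {}sub : subseq t (A ++ B) by move: sub; rewrite /join /=.
  have [s1 [s2 [def_t sub1 sub2]]] := subseq_of_cat sub.
  have gt2 : {in s2, forall x, 1 < x}.
    by move=> x xs; apply: gt1; rewrite def_t mem_cat xs orbT.
  have [|s10|s20] := connected_iso_split rgp conn iso def_t.
  - move=> x y /(mem_subseq sub1) xA ys2; apply: join_lt => //.
      exact: mem_subseq sub2 _ ys2.
    by rewrite gtn_eqF // gt2.
  - case: (s2 =P [::]) => [s20|/eqP s2N].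
      by left; apply: contains_join_left iso _; rewrite def_t s20 cats0.
    right; apply/contains_after_1_right; exists t; split=> //.
    by rewrite def_t s10; apply: join_right_after_1.
  - by left; apply: contains_join_left iso _; rewrite def_t s20 cats0.
case=> [|/contains_after_1_right[t [iso gt1 sub]]].
  case/contains_isoP=> s iso sub; exists (shiftw 1 s); split.
  - by rewrite order_iso_map //; apply: shiftw_inc.
  - by move=> x /mapP[y ys ->]; rewrite ltnS (rgw_gt0 rgu) ?(mem_subseq sub).
  - rewrite /=; apply: subseq_trans (prefix_subseq _ _); exact: map_subseq.
exists t; split=> //; apply: subseq_trans sub _.
exact: subseq_trans (suffix_subseq _ _) (subseq_cons _ _).
Qed.

(** The cases follow the letter [a] that plays the two 1s of the pattern. If [a] is 1, then [tau] is
    found after a 1 of [B], and [sigma] on one side only. If [a] is in [A], then [sigma] lies in [A]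
    and [tau] on one side only. If [a] is larger, everything lies in [B]. *)
Lemma contains_join sigma tau :
  rgw sigma -> connected sigma -> rgw tau -> connected tau ->
  containsb (join u v) (one_sig_one_tau sigma tau) <->
  [\/ containsb u (one_sig_one_tau sigma tau),
      containsb v (one_sig_one_tau sigma tau)
    | containsb u sigma /\ contains_after_1 v tau].
Proof.
move=> rgs conns rgt connt; split; last first.
  case=> [/contains_joinl//|/contains_joinr//|[/contains_isoP[s isos subs]]].
  case/contains_after_1_right=> t [isot gt1 subt].
  apply/contains_isoP; exists (1 :: shiftw 1 s ++ 1 :: t).
    apply/order_iso_patternP => //; exists 1, (shiftw 1 s), t; split=> //.
    - by split; rewrite ?order_iso_map //; apply: shiftw_inc.
    - by move=> x /mapP[y ys ->]; rewrite ltnS (rgw_gt0 rgu) ?(mem_subseq subs).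
    move=> x y xs yt; apply: join_lt; first exact: mem_subseq (map_subseq _ subs) _ xs.
      by apply: (mem_subseq subt); rewrite inE yt orbT.
    by rewrite gtn_eqF // gt1.
  by rewrite /=; apply: cat_subseq => //; apply: map_subseq.
case/contains_isoP=> q iso_q sub.
have [a [s [t [def_q [isos isot] lt_as lt_at lt_st]]]] := order_iso_patternP _ rgs rgt iso_q.
have a_in : a \in join u v by apply: (mem_subseq sub); rewrite def_q mem_head.
have [/eqP a1|aN1] := boolP (a == 1).
  have {}sub : subseq (s ++ 1 :: t) (A ++ B) by move: sub; rewrite def_q a1 /join /=.
  have N1 : 1 \notin A by apply/negP => /(join_left rgu).
  have [s1 [z [def_sz sub1 sub2]]] := subseq_cat_cons_right N1 sub.
  have gt1 : {in s, forall x, 1 < x} by move=> x /lt_as; rewrite a1.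
  have afterD : contains_after_1 v tau.
    apply/contains_after_1_right; exists t; split=> //.
      by move=> x /lt_at; rewrite a1.
    by apply: subseq_trans sub2; apply: suffix_subseq.
  have [|s10|z0] := connected_iso_split rgs conns isos def_sz.
  - move=> x y /(mem_subseq sub1) xA yz; apply: join_lt => //.
      by apply: (mem_subseq sub2); rewrite mem_cat yz.
    by rewrite gtn_eqF // gt1 // def_sz mem_cat yz orbT.
  (* With [s] empty, the second 1 may be the head of [B], so [B] need not contain the whole
     occurrence; but then [sigma] is empty and [u] contains it. *)
  - have [s0|sN0] := eqVneq s [::].
      constructor 3; split=> //; apply: contains_join_left isos _.
      by rewrite s0 sub0seq.
    (* The 1 at the head of [B] replaces the leading letter of the join. *)
    constructor 2; apply: contains_join_right iso_q _; rewrite def_q a1.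
    have -> : s = z by rewrite def_sz s10.
    case: (join_right_head u rgv) => [B0|[B' defB]].
      by move: sub2; rewrite /B B0; case: (z).
    move: sub2; rewrite -/B in defB *; rewrite defB /=.
    case def_z: z => [|y z'] /=; first by move: sN0; rewrite def_sz s10 def_z.
    case: eqP => // y1; suff : 1 < 1 by [].
    by apply: gt1; rewrite def_sz def_z y1 mem_cat mem_head orbT.
  - constructor 3; split=> //; apply: contains_join_left isos _.
    by rewrite def_sz z0 cats0.
have [a_le|a_gt] := leqP a r.+1; last first.
  constructor 2; apply: contains_join_right iso_q _.
  apply: subseq_join_right rgu rgv _ _ sub => x.
  rewrite def_q inE mem_cat inE -/r.
  by case/or4P=> [/eqP->|/lt_as|/eqP->|/lt_at] //; apply: ltn_trans.
have NaB : a \notin B.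
  apply/negP => /(join_right rgv)[/eqP|]; first by rewrite (negbTE aN1).
  by rewrite ltnNge a_le.
have {}sub : subseq ((a :: s) ++ a :: t) ((1 :: A) ++ B) by rewrite -[_ ++ _]def_q.
(* The second [a] cannot lie in [B], so only a final part of [t] can reach [B]. *)
have [t1 [t2 [def_t sub1 sub2]]] := subseq_cat_cons_left NaB sub.
have {}sub1 : subseq ((a :: s) ++ a :: t1) A by move: sub1; rewrite /= (negbTE aN1).
have subs : subseq s A.
  apply: subseq_trans sub1; rewrite -cat1s -catA.
  exact: subseq_trans (prefix_subseq _ _) (suffix_subseq _ _).
have subt1 : subseq t1 A.
  by apply: subseq_trans sub1; rewrite -cat_rcons suffix_subseq.
have gt1 : {in t, forall x, 1 < x}.
  have /andP[a_gt1 _] := join_left rgu (mem_subseq sub1 (mem_head _ _)).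
  by move=> x /lt_at; apply: ltn_trans.
have [|t10|t20] := connected_iso_split rgt connt isot def_t.
- move=> x y /(mem_subseq subt1) xA yt2; apply: join_lt => //.
    exact: mem_subseq sub2 _ yt2.
  by rewrite gtn_eqF // gt1 // def_t mem_cat yt2 orbT.
- have [t20|t2N0] := eqVneq t2 [::].
    constructor 1; apply: contains_join_left iso_q _.
    by move: sub1; rewrite def_q def_t t20 cats0.
  constructor 3; split; first exact: contains_join_left isos subs.
  apply/contains_after_1_right; exists t; split=> //.
  move: gt1; rewrite def_t t10 => gt1; exact: join_right_after_1.
- constructor 1; apply: contains_join_left iso_q _.
  by move: sub1; rewrite def_q def_t t20 cats0.
Qed.

End JoinPattern.

(** * Counting *)

(* If [word t] is [1[w_1]1[w_2]...1[w_k]], the children of [t] are the trees of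
   [w_1], ..., [w_k]. *)
Fixpoint children t := if t is Node u v then u :: children v else [::].

Definition of_children ts := foldr Node Leaf ts.

Lemma childrenK : cancel children of_children.
Proof. by elim=> //= u _ v ->. Qed.

Lemma of_childrenK : cancel of_children children.
Proof. by elim=> //= t ts ->. Qed.

Lemma nb_nodes_of_children ts : nb_nodes (of_children ts) = sumn (map (succn \o nb_nodes) ts).
Proof. by elim: ts => //= t ts ->. Qed.

Definition tcontains p t := containsb (word t) p.

Lemma child_containsP p t :
  rgw p -> connected p ->
  reflect (contains_after_1 (word t) p) (has (tcontains p) (children t)).
Proof.
move=> rgp conn; elim: t => [|u _ v IHv] /=.
  by apply: ReflectF => -[s []].
have joinP := contains_after_1_join (rgw_word u) (rgw_word v) rgp conn.
apply: (iffP orP) => [[uc|/IHv vc]|/joinP[uc|/IHv vc]]; auto.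
  by apply/joinP; left.
by apply/joinP; right.
Qed.

(** Iterating [contains_join] along the children, each new first child brings its own avoidance and
    one condition against all later children, which is the recursion of [pairwise]. *)
Lemma avoids_patternE sigma tau t (p := one_sig_one_tau sigma tau) :
  rgw sigma -> connected sigma -> rgw tau -> connected tau ->
  ~~ tcontains p t =
  all (predC (tcontains p)) (children t) &&
  pairwise (fun x y => ~~ (tcontains sigma x && tcontains tau y)) (children t).
Proof.
move=> rgs conns rgt connt; elim: t => [|u _ v IHv] /=.
  by apply/negP => /contains_isoP[q iso /=/eqP def_q]; move: iso; rewrite def_q.
have -> : tcontains p (Node u v) =
    [|| tcontains p u, tcontains p v
      | tcontains sigma u && has (tcontains tau) (children v)].
  have joinP := contains_join (rgw_word u) (rgw_word v) rgs conns rgt connt.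
  apply/idP/or3P => [/joinP[]|cases]; try by [constructor 1|constructor 2].
    by case=> us /(child_containsP _ rgt connt) vt; constructor 3; rewrite /tcontains us.
  apply/joinP; case: cases => [uc|vc|/andP[us /(child_containsP _ rgt connt) vt]].
  - by constructor 1.
  - by constructor 2.
  - by constructor 3.
rewrite !negb_or IHv -all_predC.
have -> : ~~ (tcontains sigma u && has (tcontains tau) (children v)) =
          all (fun y => ~~ (tcontains sigma u && tcontains tau y)) (children v).
  by case: (tcontains sigma u) => /=; rewrite ?all_predT // -all_predC.
by rewrite -!andbA [pairwise _ _ && _]andbC.
Qed.

(* The first argument bounds the recursion; the list is complete once it is at
   least [n]. *)
Fixpoint trees_upto k n : seq tree :=
  match k, n with
  | _, 0 => [:: Leaf]
  | 0, _.+1 => [::]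
  | k'.+1, n'.+1 =>
    [seq Node p.1 p.2 | m <- iota 0 n'.+1,
       p <- [seq (u, v) | u <- trees_upto k' m, v <- trees_upto k' (n' - m)]]
  end.

Lemma trees_uptoS k n :
  trees_upto k.+1 n.+1 =
    [seq Node p.1 p.2 | m <- iota 0 n.+1,
       p <- [seq (u, v) | u <- trees_upto k m, v <- trees_upto k (n - m)]].
Proof. by []. Qed.

Lemma nb_nodes_trees_upto k n t : t \in trees_upto k n -> nb_nodes t = n.
Proof.
elim: k n t => [|k IHk] [|n] t; try by [rewrite inE => /eqP->|].
rewrite trees_uptoS => /allpairsPdep[m [[a b] [m_n /allpairsP[[u v]]]]].
move=> [/IHk/= szu /IHk/= szv [-> ->]] -> /=.
by move: m_n; rewrite szu szv mem_iota; lia.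
Qed.

Lemma mem_trees_upto k n t : n <= k -> (t \in trees_upto k n) = (nb_nodes t == n).
Proof.
move=> le_nk; apply/idP/eqP => [/nb_nodes_trees_upto //|].
elim: k n t le_nk => [|k IHk] [|n] [|u v] // le [sz].
rewrite trees_uptoS; apply/allpairsPdep; exists (nb_nodes u), (u, v); split=> //.
  by rewrite mem_iota; lia.
by apply: allpairs_f; apply: IHk => //; lia.
Qed.

Lemma trees_upto_uniq k n : uniq (trees_upto k n).
Proof.
elim: k n => [|k IHk] [|n] //; rewrite trees_uptoS.
apply: allpairs_uniq_dep; first exact: iota_uniq.
  by move=> m _; apply: allpairs_uniq => // -[u v] [u' v'] _ _.
move=> _ _ /allpairsPdep[m [p [_ yin ->]]] /allpairsPdep[m' [p' [_ yin' ->]]] /=.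
(* The node count of the left subtree recovers the index [m]. *)
case/allpairsP: yin => -[u v] /= [/nb_nodes_trees_upto <- _ ->].
case/allpairsP: yin' => -[u' v'] /= [/nb_nodes_trees_upto <- _ ->] /=.
by case=> -> ->.
Qed.

(** * Avoiders counted as trees *)

Lemma rgw_from_leq_size m s x : rgw_from m s -> x \in s -> x <= m + size s.
Proof.
elim: s m => //= y s IHs m /andP[/andP[_ ley] /IHs le].
by rewrite inE => /orP[/eqP->|/le]; lia.
Qed.

Lemma rgw_tuple n w :
  rgw w -> size w = n -> exists t : n.-tuple 'I_n.+1, w = map val t.
Proof.
move=> rgw_w sz.
have szt : size (map (@inord n) w) == n by rewrite size_map sz.
exists (Tuple szt); rewrite /= -map_comp map_id_in // => x xw /=.
by rewrite inordK // ltnS -sz (rgw_from_leq_size rgw_w).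
Qed.

(** Both sides list the same avoiding words without repetition: tuples through their values, trees
    through [word], which is injective and reaches every non-crossing restricted growth word. *)
Lemma avoid_count_trees n p :
  avoid_count n p = count (predC (tcontains p)) (trees_upto n n).
Proof.
pose toword (t : n.-tuple 'I_n.+1) : seq nat := map val t.
pose avoider w := rgw w && ~~ containsb w [:: 1; 2; 1; 2] && ~~ containsb w p.
rewrite /avoid_count cardE -(size_map toword).
transitivity (size (filter (fun w => ~~ containsb w p) (map word (trees_upto n n)))).
  apply/perm_size/uniq_perm.
  - rewrite map_inj_uniq ?enum_uniq // => t t' /(inj_map val_inj); exact: val_inj.
  - by rewrite filter_uniq // (map_inj_uniq word_inj) trees_upto_uniq.
  move=> w; rewrite mem_filter; apply/mapP/andP => [[t]|[avw]].
    rewrite mem_enum inE => /andP[/andP[rgt nct] avt] ->; split=> //.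
    have [t' def_t] := word_surj rgt nct; apply/mapP; exists t' => //.
    by rewrite mem_trees_upto // -size_word -def_t size_map size_tuple.
  case/mapP=> t tT def_w.
  have [||t' def_t] := @rgw_tuple n w; rewrite ?def_w ?rgw_word //.
    by rewrite size_word; apply: nb_nodes_trees_upto tT.
  exists t'; last by rewrite -def_w.
  rewrite mem_enum inE -def_t avw def_w rgw_word andbT; exact: noncrossing_word.
by rewrite size_filter count_map.
Qed.

(** * Rearrangements of lists *)

Lemma perm_flatten_map (S T : eqType) (F G : S -> seq T) s :
  {in s, forall x, perm_eq (F x) (G x)} ->
  perm_eq (flatten (map F s)) (flatten (map G s)).
Proof.
elim: s => //= x s IHs FG; apply: perm_cat; first by apply: FG; rewrite mem_head.
by apply: IHs => y ys; apply: FG; rewrite inE ys orbT.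
Qed.

Lemma pairwise_rev (T : Type) (r : rel T) s :
  pairwise r (rev s) = pairwise (fun x y => r y x) s.
Proof. by elim: s => //= x s IHs; rewrite rev_cons pairwise_rcons all_rev IHs. Qed.

Lemma perm_eq_bool (s t : seq bool) :
  size s = size t -> count id s = count id t -> perm_eq s t.
Proof.
move=> sz cnt.
have E (r : seq bool) : count_mem true r = count id r.
  by apply: eq_count => -[].
have E' (r : seq bool) : count_mem false r = size r - count id r.
  by rewrite -(count_predC id r) addKn; apply: eq_count => -[].
by apply/allP => -[] _ /=; rewrite ?E ?E' ?sz cnt.
Qed.

(** Reversing the children is an involution on trees that keeps the number of nodes. *)
Lemma perm_rev_children k n : n <= k ->
  perm_eq (map (rev \o children) (trees_upto k n)) (map children (trees_upto k n)).
Proof.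
move=> le_nk; pose flip t := of_children (rev (children t)).
have flipK : involutive flip by move=> t; rewrite /flip of_childrenK revK childrenK.
have nb_flip t : nb_nodes (flip t) = nb_nodes t.
  by rewrite -{2}[t]childrenK !nb_nodes_of_children map_rev sumn_rev.
have -> : map (rev \o children) (trees_upto k n) = map children (map flip (trees_upto k n)).
  by rewrite -map_comp; apply: eq_map => t /=; rewrite of_childrenK.
apply/perm_map/uniq_perm; rewrite ?(map_inj_uniq (inv_inj flipK)) ?trees_upto_uniq //.
by move=> t; rewrite -{1}[t]flipK (mem_map (inv_inj flipK)) !mem_trees_upto // nb_flip.
Qed.

(** * Joint distribution of avoidance and containment *)

Section Equidistribution.
Variables sigma tau : seq nat.
Hypotheses (rgs : rgw sigma) (conns : connected sigma).
Hypotheses (rgt : rgw tau) (connt : connected tau).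

Let p := one_sig_one_tau sigma tau.
Let p' := one_sig_one_tau tau sigma.
Let key q t := (~~ tcontains q t, tcontains sigma t, tcontains tau t).
(** The criterion of [avoids_patternE] read on the keys of the children: [k.1.1] is the avoidance
    bit, [x.1.2] tells containment of [sigma] and [y.2] that of [tau]. *)
Let valid (ks : seq (bool * bool * bool)) :=
  all (fun k => k.1.1) ks && pairwise (fun x y => ~~ (x.1.2 && y.2)) ks.

Lemma tcontains_pattern a b t :
  tcontains (one_sig_one_tau a b) t -> tcontains a t && tcontains b t.
Proof.
have inc r q : increasing_on q (addn r) by move=> x y _ _; apply: shiftw_inc.
move=> cont; apply/andP; split; apply: contains_pattern (@inc _ _) _ cont.
  by apply: subseq_trans (suffix_subseq [:: 1] _); apply: prefix_subseq.
by rewrite /one_sig_one_tau !catA; apply: suffix_subseq.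
Qed.

(** The keys for [p] and [p'] can differ only in the avoidance bit, and only on trees containing
    both [sigma] and [tau]. On these the other two bits are constant, so the number of avoiders
    fixes the multiset of keys. *)
Lemma perm_eq_keys (T : seq tree) :
  count (predC (tcontains p)) T = count (predC (tcontains p')) T ->
  perm_eq (map (key p) T) (map (key p') T).
Proof.
pose both t := tcontains sigma t && tcontains tau t.
have subp t : tcontains p t -> both t by apply: tcontains_pattern.
have subp' t : tcontains p' t -> both t.
  by move/tcontains_pattern; rewrite andbC.
have permT := permEl (perm_filterC both T).
rewrite -(permPl (perm_map (key p) permT)) -(permPr (perm_map (key p') permT)).
rewrite -!(permP permT) !map_cat !count_cat.
have cntC q : (forall t, tcontains q t -> both t) ->
    count (predC (tcontains q)) (filter (predC both) T) = size (filter (predC both) T).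
  move=> subq; apply/eqP; rewrite -all_count; apply/allP => t.
  by rewrite mem_filter => /andP[/= nb _]; apply: contra nb; apply: subq.
(* Trees lacking [sigma] or [tau] avoid both patterns, so their contributions to the two counts
   cancel. *)
rewrite !cntC // => /addIn cnt.
have -> : map (key p) (filter (predC both) T) = map (key p') (filter (predC both) T).
  apply/eq_in_map => t; rewrite mem_filter => /andP[/= nb _].
  rewrite /key; congr (_, _, _).
  by rewrite (contra (subp t) nb) (contra (subp' t) nb).
rewrite perm_cat2r.
have keyE q : map (key q) (filter both T) =
    map (fun b => (b, true, true)) (map (predC (tcontains q)) (filter both T)).
  rewrite -map_comp; apply/eq_in_map => t; rewrite mem_filter => /andP[/andP[st tt] _].
  by rewrite /key /= st tt.
by rewrite !keyE; apply/perm_map/perm_eq_bool; rewrite ?size_map // !count_map.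
Qed.

Lemma avoids_valid t : ~~ tcontains p t = valid (map (key p) (children t)).
Proof. by rewrite avoids_patternE // /valid all_map pairwise_map. Qed.

(** Exchanging [sigma] and [tau] in the pairwise condition amounts to reading the children from
    right to left. *)
Lemma avoids_valid_rev t : ~~ tcontains p' t = valid (map (key p') (rev (children t))).
Proof.
rewrite avoids_patternE // /valid all_map all_rev pairwise_map pairwise_rev.
by congr (_ && _); apply: eq_pairwise => x y; rewrite andbC.
Qed.

(** Avoidance depends only on the list of keys of the children, so the hypothesis carries the count
    of valid lists from [p] to [p']. Reversing the children turns it into the count of
    [p']-avoiders, and [perm_eq_keys] restores the full keys. *)
Lemma equidistribution_keys k n : n <= k ->
  perm_eq (map (map (key p) \o children) (trees_upto k n))
          (map (map (key p') \o children) (trees_upto k n)) ->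
  perm_eq (map (key p) (trees_upto k n)) (map (key p') (trees_upto k n)).
Proof.
move=> le_nk eq_keys; apply: perm_eq_keys.
transitivity (count valid (map (map (key p) \o children) (trees_upto k n))).
  by rewrite count_map; apply: eq_count => t; apply: avoids_valid.
rewrite (permP eq_keys) map_comp.
rewrite -(permP (perm_map (map (key p')) (perm_rev_children le_nk))).
by rewrite -map_comp count_map; apply: eq_count => t; rewrite /= avoids_valid_rev.
Qed.

Lemma equidistribution k n : n <= k ->
  perm_eq (map (key p) (trees_upto k n)) (map (key p') (trees_upto k n)).
Proof.
move=> le_nk; apply: equidistribution_keys => //.
(* The induction runs on lists of keys of children. For [Node u v] this list is the key of [u]
   followed by the list for [v]: the induction hypothesis gives the former through
   [equidistribution_keys] and the latter directly. *)
elim: k n le_nk => [|k IHk] [|n] // le_nk.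
rewrite trees_uptoS !map_allpairs; apply: perm_flatten_map => m.
rewrite mem_iota => /andP[_ lt_mn].
have le_mk : m <= k by lia.
have le_nmk : n - m <= k by lia.
have factor q :
    [seq (map (key q) \o children) (Node x.1 x.2)
       | x <- [seq (u, v) | u <- trees_upto k m, v <- trees_upto k (n - m)]] =
    [seq a :: b | a <- map (key q) (trees_upto k m),
                  b <- map (map (key q) \o children) (trees_upto k (n - m))].
  by rewrite map_allpairs allpairs_mapl allpairs_mapr.
rewrite !factor; apply: perm_allpairs; last exact: IHk.
by apply: equidistribution_keys => //; apply: IHk.
Qed.

End Equidistribution.

Theorem theorem3p7 (sigma tau : seq nat) :
  rgw sigma -> connected sigma -> noncrossing sigma ->
  rgw tau -> connected tau -> noncrossing tau ->
  forall n : nat,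
    avoid_count n (one_sig_one_tau sigma tau) =
    avoid_count n (one_sig_one_tau tau sigma).
Proof.
move=> rgs conns _ rgt connt _ n; rewrite !avoid_count_trees.
have /permP eq_cnt := equidistribution rgs conns rgt connt (leqnn n).
(* Counting the keys whose avoidance bit is set gives the numbers of avoiders. *)
by have := eq_cnt (fun k => k.1.1); rewrite !count_map.
Qed.
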